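(* Let $l$ be a positive integer. For every partition $\mathbb{Z}^{+}=C_{1}\uplus C_{2}\uplus\dots\uplus C_{l}$ of the set of positive integers into $l$ pairwise disjoint classes, there exist an $i\in\{1,2,\dots,l\}$ and $x,y,z\in C_{i}$ such that $x+y=z$ and $x$ divides $y$. Moreover, there is a number $S'(l)$, depending only on $l$, such that for every such partition $x,y,z$ can be chosen to be $\leq S'(l)$.
   Context: $\mathbb{Z}^{+}$ denotes the set of positive integers and $\uplus$ denotes disjoint union. The elements $x,y,z$ are not required to be distinct. *)

(* Defs.v *)
From mathcomp Require Import all_boot.
From mathcomp Require Import boolp classical_sets.

Set Implicit Arguments.
Unset Strict Implicit.
Unset Printing Implicit Defensive.

Local Open Scope classical_set_scope.

(* As for the disjoint union C_1 \uplus ... \uplus C_l, some of the classes may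
   be empty; this is why [classical_sets.partition], which requires every block
   to be nonempty, is not used. *)
Definition disjoint_union_of (T : Type) (l : nat) (A : set T)
    (C : 'I_l -> set T) : Prop :=
  A = \bigcup_(i in setT) C i /\ trivIset setT C.

Definition posnat : set nat := [set n | 0 < n].

(* Main.v *)
Require Import Defs.
From mathcomp Require Import all_boot.
From mathcomp Require Import boolp classical_sets.

(** The proof is Schur's, applied to a sparse set of integers. Take integers
    a 0 < a 1 < ... and colour the pair i < j by the class of a j - a i. If i, j
    and k span a monochromatic triangle, then x := a j - a i, y := a k - a j and
    z := a k - a i lie in one class and x + y = z. The divisibility of y by x is
    built into the sequence: since a m.+1 - a m is the factorial of a m, it is
    a multiple of every difference a j - a i with i < j <= m, and y is a sum of
    such increments (lemma [dvdn_factorial_walk]).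

    Ramsey's theorem for triangles ([ramsey_triangle]) produces i, j and k below
    some N that depends only on the number of colours, so a N bounds x, y and z
    whatever the partition is. *)

Lemma negb_pairwiseP (T : eqType) (r : rel T) (s : seq T) :
  ~~ pairwise r s -> exists x y, subseq [:: x; y] s /\ ~~ r x y.
Proof.
elim: s => [|v t IHt] //=; rewrite negb_and => /orP[/allPn[y yt nrvy]|].
  by exists v, y; rewrite eqxx sub1seq.
move=> /IHt[x [y [xyt nrxy]]]; exists x, y; split => //.
exact: (subseq_trans xyt (subseq_cons t v)).
Qed.

Lemma pigeonhole_seq (T : eqType) (F : finType) (f : T -> F) (K : {set F})
    (N : nat) (s : seq T) :
  all (fun x => f x \in K) s -> #|K| * N < size s ->
  exists2 k, k \in K & N < count (fun x => f x == k) s.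
Proof.
move=> fK lt_s.
suff /exists_inP[k kK Nk] : [exists k in K, N < count (fun x => f x == k) s].
  by exists k.
apply: contraLR lt_s; rewrite negb_exists_in -leqNgt => /forall_inP small.
have -> : size s = \sum_(k in K) count (fun x => f x == k) s.
  elim: s fK {small} => [|x s IHs] /=; first by rewrite big1.
  move=> /andP[xK /IHs ->]; rewrite big_split -add1n /=; congr (_ + _).
  rewrite (bigD1 (f x)) //= eqxx big1 ?addn0 // => k /andP[_].
  by rewrite eq_sym => /negbTE ->.
by rewrite -sum_nat_const leq_sum // => k /small; rewrite -leqNgt.
Qed.

(** Restricting the colours to a set K makes the induction on the number of
    colours possible: among the points joined to the first one by a colour
    k that occurs there more than N times, either two are joined by k, which closes a triangle, or
    the colour k has disappeared. Subsequences replace an order on the points: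
    only c x y for x before y in s matters. *)
Lemma ramsey_triangle (F : finType) (n : nat) :
  exists N, forall (T : eqType) (c : T -> T -> F) (K : {set F}) (s : seq T),
    #|K| = n -> pairwise (fun x y => c x y \in K) s -> N < size s ->
  exists x y z, [/\ subseq [:: x; y; z] s, c x y = c x z & c y z = c x z].
Proof.
elim: n => [|n [N IHn]].
  exists 1 => T c K [|x [|y s]] //= /cards0_eq -> /andP[/andP[]].
  by rewrite inE.
exists (n.+1 * N).+1 => T c K [|v t] //= cardK /andP[vK tK] lt_t.
have [k kK Nk] : exists2 k, k \in K & N < count (fun x => c v x == k) t.
  by apply: pigeonhole_seq => //; rewrite cardK.
set t' := [seq x <- t | c v x == k].
have t't : subseq t' t by apply: filter_subseq.
have [no_k|] := boolP (pairwise (fun x y => c x y != k) t'); last first.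
  move=> /negb_pairwiseP[x [y [xyt' /negPn/eqP cxy]]].
  have vk w : w \in [:: x; y] -> c v w = k.
    by move=> /(mem_subseq xyt'); rewrite mem_filter => /andP[/eqP].
  exists v, x, y; rewrite !vk ?inE ?eqxx ?orbT //; split => //.
  exact: subseq_trans xyt' t't.
have cardK' : #|K :\ k| = n.
  by move: cardK; rewrite (cardsD1 k) kK => -[].
have t'K : pairwise (fun x y => c x y \in K :\ k) t'.
  have : pairwise [rel x y | (c x y != k) && (c x y \in K)] t'.
    by rewrite pairwise_relI no_k (subseq_pairwise t't).
  by apply: sub_pairwise => x y; rewrite finset.in_setD1.
have [|x [y [z [xyz cxy cyz]]]] := IHn _ _ _ _ cardK' t'K.
  by rewrite size_filter.
exists x, y, z; split => //.
exact: subseq_trans (subseq_trans xyz t't) (subseq_cons t v).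
Qed.

Definition factorial_walk (n : nat) : nat := iter n (fun m => m + m`!) 0.

Lemma factorial_walk_ltn {i j : nat} :
  i < j -> factorial_walk i < factorial_walk j.
Proof.
apply: (homo_ltn ltn_trans) => m /=.
by rewrite -[X in X < _]addn0 ltn_add2l fact_gt0.
Qed.

Lemma dvdn_factorial_walk {i j k : nat} : i < j -> j <= k ->
  factorial_walk j - factorial_walk i %| factorial_walk k - factorial_walk j.
Proof.
move=> ij; have mono := ltnW_homo (@factorial_walk_ltn).
elim: k => [|k IHk]; first by rewrite leqn0 => /eqP ->; rewrite subnn.
rewrite leq_eqVlt => /predU1P[->|]; first by rewrite subnn.
rewrite ltnS => jk; rewrite /= addnC -addnBA ?mono // dvdn_add ?IHk //.
rewrite dvdn_fact // subn_gt0 factorial_walk_ltn //=.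
exact: leq_trans (leq_subr _ _) (mono _ _ jk).
Qed.

Theorem theorem4 (l : nat) (l_gt0 : 0 < l) :
  (forall C : 'I_l -> set nat, disjoint_union_of posnat C ->
     exists (i : 'I_l) (x y z : nat),
       [/\ C i x, C i y & C i z] /\ x + y = z /\ x %| y)
  /\
  (exists S' : nat,
     forall C : 'I_l -> set nat, disjoint_union_of posnat C ->
     exists (i : 'I_l) (x y z : nat),
       [/\ C i x, C i y & C i z] /\ x + y = z /\ x %| y /\
       [/\ x <= S', y <= S' & z <= S']).
Proof.
set bounded := (X in _ /\ X); suff bP : bounded.
  split=> // C hC; have [S' /(_ C hC)[i [x [y [z [? [? [? _]]]]]]]] := bP.
  by exists i, x, y, z.
have [N HN] := ramsey_triangle 'I_l #|[set: 'I_l]|.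
exists (factorial_walk N) => C [Cpos _].
have class_of n : exists i, 0 < n -> C i n.
  have [n0|n_gt0] := posnP n; first by exists (Ordinal l_gt0); rewrite n0.
  have : posnat n by [].
  by rewrite Cpos => -[i _ Cin]; exists i.
have [col colP] := boolp.choice class_of.
pose a := factorial_walk.
have mono := ltnW_homo (@factorial_walk_ltn).
have [||i [j [k [ijk cij cjk]]]] :=
    HN _ (fun i j => col (a j - a i)) [set: 'I_l] (iota 0 N.+1) erefl.
- by apply/(pairwiseP 0) => i j _ _ _; rewrite inE.
- by rewrite size_iota.
have /and3P[ij jk _] : sorted ltn [:: i; j; k].
  exact: subseq_sorted ltn_trans _ _ ijk (iota_ltn_sorted _ _).
have kN : k <= N.
  have : k \in iota 0 N.+1 by apply: (mem_subseq ijk); rewrite !inE eqxx !orbT.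
  by rewrite mem_iota.
have aij := factorial_walk_ltn ij; have ajk := factorial_walk_ltn jk.
have aik := ltn_trans aij ajk.
have le_aN m p : m <= N -> a m - a p <= a N.
  by move=> mN; apply: leq_trans (leq_subr _ _) (mono _ _ mN).
exists (col (a k - a i)), (a j - a i), (a k - a j), (a k - a i).
split; first split.
- by rewrite -cij; apply: colP; rewrite subn_gt0.
- by rewrite -cjk; apply: colP; rewrite subn_gt0.
- by apply: colP; rewrite subn_gt0.
split; first by rewrite addnC addnBA ?subnK // ltnW.
split; first exact: dvdn_factorial_walk (ltnW jk).
by split; apply: le_aN => //; apply: leq_trans (ltnW jk) kN.
Qed.
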